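(* Let $w$ and $y_1,y_2,\dots$ be indeterminates, and let $Y_1,Y_2,\dots$ be the sequence determined by $$s_N(Y_1,\dots,Y_N)=\Big\langle\emptyset\Big|\exp\Big(\sum_{k\ge1}y_k\widetilde L_k\Big)\Big|(N)\Big\rangle\qquad\text{for all }N\ge1,$$ i.e. by comparing the matrix elements $\langle\emptyset|\cdot|(N)\rangle$ of $\exp(\sum_k Y_ka_k)$ and $\exp(\sum_k y_k\widetilde L_k)$. Then for every $N\ge1$, $$Y_N=C_Nw+D_N,$$ where $C_N$ and $D_N$ are polynomials in the indeterminates $y_i$ (not depending on $w$).
   Context: The space has basis $|\lambda\rangle$ indexed by Young diagrams, with $\langle\lambda|\mu\rangle=\delta_{\lambda\mu}$; $\lambda$ is identified with the particle configuration $\{\lambda_i-i+\frac12:i\ge1\}\subset\mathbb{Z}+\frac12$. $(N)$ is the one-row diagram with $N$ boxes and $\emptyset$ the empty diagram. For $k\ge1$ the operator $\widetilde L_k$ (depending on $w$) acts by $$\widetilde L_k|\lambda\rangle=\sum_\mu(-1)^{\mathrm{height}-1}\left(w+\mathrm{Start}+\tfrac k2\right)|\mu\rangle,$$ the sum being over all $\mu$ obtained from $\lambda$ by removing a rim-hook of $k$ boxes (a connected skew diagram $\lambda/\mu$ lying on the rim of $\lambda$), equivalently by moving one particle of $\lambda$ from position $\mathrm{Start}+k$ to the unoccupied position $\mathrm{Start}$ (so $\mathrm{Start}$ is the left end of the jump); height is the number of rows of the rim-hook. The Heisenberg operator $a_k$ acts by $a_k|\lambda\rangle=\sum_\mu(-1)^{\mathrm{height}-1}|\mu\rangle$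 over the same $\mu$. The polynomials $s_N$ are defined by $\sum_{N\ge0}s_N(Y_1,Y_2,\dots)u^N=\exp\left(\sum_{i\ge1}Y_iu^i\right)$. *)

(* Defs.v *)
From HB Require Import structures.
From mathcomp Require Import all_boot all_order all_algebra finmap zify.
From mathcomp Require Export monalg.

Set Implicit Arguments.
Unset Strict Implicit.
Unset Printing Implicit Defensive.

Import GRing.Theory.
Local Open Scope ring_scope.

Record diagram := Diagram {
  rows :> seq nat;
  _ : sorted geq rows && (0%N \notin rows) }.

HB.instance Definition _ := [isSub for rows].
HB.instance Definition _ := [Choice of diagram by <:].

(* Rows and columns are numbered from 0. *)
Definition row_len (la : diagram) (i : nat) : nat := nth 0%N la i.

Definition nbox (la : diagram) : nat := sumn la.

Lemma one_row_proof N : sorted geq (nseq (0 < N) N) && (0%N \notin nseq (0 < N) N).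
Proof. by case: N => [|N]. Qed.

Definition one_row (N : nat) : diagram := Diagram (one_row_proof N).

Definition empty_diagram : diagram := one_row 0.

Definition contained (mu la : diagram) : bool :=
  all (fun i => row_len mu i <= row_len la i)%N (iota 0 (size mu)).

Fixpoint below_seqs (s : seq nat) : seq (seq nat) :=
  if s is a :: s' then
    [::] :: [seq b :: t | b <- iota 1 a, t <- below_seqs s']
  else [:: [::]].

(* The duplicate-free list of the diagrams contained in la, see mem_below and
   below_uniq. *)
Definition below (la : diagram) : seq diagram := pmap insub (below_seqs la).

Definition skew (la mu : diagram) : seq (nat * nat) :=
  [seq (i, j) | i <- iota 0 (size la),
                j <- iota (row_len mu i) (row_len la i - row_len mu i)].

Definition adjacent (b c : nat * nat) : bool :=
  (b.1 == c.1) && ((b.2 == c.2.+1) || (c.2 == b.2.+1)) ||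
  (b.2 == c.2) && ((b.1 == c.1.+1) || (c.1 == b.1.+1)).

Definition connected_boxes (s : seq (nat * nat)) : bool :=
  [forall b : seq_sub s, forall c : seq_sub s,
     connect (fun b c : seq_sub s => adjacent (val b) (val c)) b c].

(* A box (i, j) lies on the rim of la when (i + 1, j + 1) is not a box of la. *)
Definition on_rim (la : diagram) (s : seq (nat * nat)) : bool :=
  all (fun b => row_len la b.1.+1 <= b.2.+1)%N s.

Definition rim_hook (k : nat) (la mu : diagram) : bool :=
  [&& contained mu la, size (skew la mu) == k,
      connected_boxes (skew la mu) & on_rim la (skew la mu)].

Definition height (la mu : diagram) : nat := size (undup (unzip1 (skew la mu))).

(* The integer s stands for the position s + 1/2, so that row i, counted from 0,
   gives the particle at la_(i+1) - (i+1) + 1/2. *)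
Definition particle (la : diagram) (i : nat) : int :=
  (row_len la i)%:Z - (i.+1)%:Z.

(* The position occupied in mu and not in la. When mu is contained in la, the
   particles of index at least size la are the same in mu and la, and lie to the
   left of all the others, so it is enough to compare the first size la ones. *)
Definition jump_start (la mu : diagram) : int :=
  head 0 [seq s <- [seq particle mu i | i <- iota 0 (size la)]
         | s \notin [seq particle la i | i <- iota 0 (size la)]].

Notation ypoly F := {malg F[{cmonom nat}]}.
Notation wypoly F := {poly ypoly F}.
Notation fock F := {malg (wypoly F)[diagram]}.

Section Operators.
Variable F : fieldType.

Definition scal (c : F) : wypoly F := (c%:MP)%:P.

Definition position (s : int) : F := s%:~R + 2^-1.

Definition indet_w : wypoly F := 'X.

(* For k >= 1, the indeterminate y_k is the variable of index k - 1. *)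
Definition indet_y (k : nat) : wypoly F := (<< ucm k.-1 >> : ypoly F)%:P.

Definition ket (la : diagram) : fock F := << la >>.

Definition lin (T : diagram -> fock F) (v : fock F) : fock F :=
  \sum_(la <- msupp v) v@_la *: T la.

Definition hook_op (c : int -> wypoly F) (k : nat) (la : diagram) : fock F :=
  \sum_(mu <- below la | rim_hook k la mu)
    ((-1) ^+ (height la mu).-1 * c (jump_start la mu)) *: ket mu.

Definition Ltilde (k : nat) : diagram -> fock F :=
  hook_op (fun s => indet_w + scal (position s) + scal (k%:R / 2)) k.

Definition heis (k : nat) : diagram -> fock F := hook_op (fun=> 1) k.

(* The operator \sum_(k >= 1) Y_k T_k, for T_k removing rim-hooks of k boxes:
   the terms with k > |la| vanish on la, see hook_op_eq0. *)
Definition op_sum (Y : nat -> wypoly F) (T : nat -> diagram -> fock F)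
    (la : diagram) : fock F :=
  \sum_(1 <= k < (nbox la).+1) Y k *: T k la.

(* exp(T) for T decreasing the number of boxes: the terms of the exponential
   series with m > |la| vanish on la, see iter_lin_eq0 and
   hook_op_sum_lowering. *)
Definition op_exp (T : diagram -> fock F) (la : diagram) : fock F :=
  \sum_(m < (nbox la).+1) scal (m`!%:R^-1) *: iter m (lin T) (ket la).

Definition braket (mu : diagram) (v : fock F) : wypoly F := v@_mu.

(* The coefficient of u^N in exp(\sum_i Y_i u^i): the terms with i > N of the
   inner sum, and m > N of the exponential series, do not contribute to it, see
   schur_trunc. *)
Definition schur (N : nat) (Y : nat -> wypoly F) : wypoly F :=
  \sum_(m < N.+1)
    scal (m`!%:R^-1) * ((\sum_(1 <= i < N.+1) (Y i)%:P * 'X^i) ^+ m)`_N.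

Lemma row_len_sum n (la : diagram) : (size la <= n)%N ->
  nbox la = (\sum_(0 <= i < n) row_len la i)%N.
Proof.
move=> le_n; rewrite /nbox sumnE (big_nth 0%N) (big_cat_nat _ le_n) //=.
rewrite [X in (_ + X)%N]big1_seq ?addn0 // => i /andP[_].
by rewrite mem_index_iota => /andP[le_i _]; rewrite /row_len nth_default.
Qed.

Lemma containedP (mu la : diagram) :
  reflect (forall i, row_len mu i <= row_len la i)%N (contained mu la).
Proof.
apply: (iffP allP) => [H i|H i _]; last exact: H.
case: (ltnP i (size mu)) => [lt_i|le_i]; first by apply: H; rewrite mem_iota.
by rewrite /row_len nth_default.
Qed.

Lemma row_len_gt0 (la : diagram) i : (0 < row_len la i)%N = (i < size la)%N.
Proof.
case: (ltnP i (size la)) => [lt_i|le_i]; last by rewrite /row_len nth_default.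
rewrite lt0n; apply: contraTneq (valP la) => /= e; rewrite negb_and negbK.
by rewrite -e mem_nth // orbT.
Qed.

Lemma contained_size (mu la : diagram) :
  contained mu la -> (size mu <= size la)%N.
Proof.
move/containedP => H; rewrite leqNgt; apply/negP => lt.
have := H (size la); rewrite {2}/row_len nth_default // leqn0.
by rewrite -leqn0 leqNgt row_len_gt0 lt.
Qed.

Lemma size_skew (la mu : diagram) : contained mu la ->
  (size (skew la mu) + nbox mu)%N = nbox la.
Proof.
move=> c; have le_s := contained_size c.
rewrite (row_len_sum le_s) (row_len_sum (leqnn (size la))).
rewrite /skew size_allpairs_dep sumnE big_map /index_iota subn0 -big_split /=.
apply: eq_bigr => i _; rewrite size_iota subnK //.
exact/containedP.
Qed.

Lemma mem_below_seqs s t : (t \in below_seqs s) =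
  [&& size t <= size s, 0%N \notin t &
      all (fun i => nth 0 t i <= nth 0 s i) (iota 0 (size t))]%N.
Proof.
elim: s t => [|a s IHs] [|b t] //=.
rewrite in_cons /=; apply/allpairsPdep/idP => [[x [y []]]|].
  rewrite mem_iota => /andP[x0 xa]; rewrite IHs => /and3P[h1 h2 h3] [-> ->].
  rewrite ltnS h1 in_cons negb_or h2 eq_sym -lt0n x0 /= -ltnS xa /=.
  by rewrite -[1%N]addn0 iotaDl all_map.
rewrite ltnS in_cons negb_or => /and3P[h1 /andP[b0 h2] /andP[ba h3]].
exists b, t; split=> //; first by rewrite mem_iota lt0n eq_sym b0 add1n ltnS.
rewrite IHs h1 h2 /=.
by move: h3; rewrite -[1%N]addn0 iotaDl all_map.
Qed.

Lemma below_seqs_uniq s : uniq (below_seqs s).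
Proof.
elim: s => [|a s IHs] //=; apply/andP; split.
  by apply/negP => /allpairsPdep[x [y []]].
by rewrite allpairs_uniq // ?iota_uniq // => -[x y] [x' y'] _ _ [-> ->].
Qed.

Lemma mem_below la mu : (mu \in below la) = contained mu la.
Proof.
rewrite mem_pmap_sub /= mem_below_seqs.
have /andP[_ ->] /= := valP mu; apply/andP/idP => [[]|c] //.
by split=> //; apply: contained_size.
Qed.

Lemma below_uniq la : uniq (below la).
Proof. exact/pmap_sub_uniq/below_seqs_uniq. Qed.

Lemma rim_hook_nbox k la mu : rim_hook k la mu -> (k + nbox mu)%N = nbox la.
Proof. by case/and4P => c /eqP <- _ _; apply: size_skew. Qed.

Lemma hook_op_eq0 c k la : (nbox la < k)%N -> hook_op c k la = 0.
Proof.
move=> lt_k; apply: big1_seq => mu /andP[/rim_hook_nbox e _].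
by move: lt_k; rewrite -e ltnNge leq_addr.
Qed.

(* T decreases the number of boxes. *)
Definition lowering (T : diagram -> fock F) : Prop :=
  forall la mu, (T la)@_mu != 0 -> (nbox mu < nbox la)%N.

Lemma lin_coef T v mu : (lin T v)@_mu = \sum_(la <- msupp v) v@_la * (T la)@_mu.
Proof. by rewrite /lin raddf_sum /=; apply: eq_bigr => la _; rewrite mcoeffZ. Qed.

Lemma iter_lin_eq0 T m la : lowering T -> (nbox la < m)%N ->
  iter m (lin T) (ket la) = 0.
Proof.
move=> lT lt_m; suff H mu : (iter m (lin T) (ket la))@_mu != 0 ->
    (m + nbox mu <= nbox la)%N.
  apply/malgP => mu; rewrite mcoeff0; apply/eqP; apply: contraLR lt_m => /H le.
  by rewrite -leqNgt; apply: leq_trans le; apply: leq_addr.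
elim: m mu {lt_m} => [|m IHm] mu /=.
  by rewrite /ket mcoeffU; case: (la =P mu) => [->|_]; rewrite ?eqxx.
rewrite lin_coef => nz.
have /existsP: exists nu : msupp (iter m (lin T) (ket la)),
    ((T (val nu))@_mu != 0).
  apply/existsP; apply: contraNT nz; rewrite negb_exists => /forallP H.
  apply/eqP; rewrite big1_seq // => nu /andP[_ nuS].
  by have := H [` nuS]%fset; rewrite negbK => /eqP /= ->; rewrite mulr0.
case/existsP => nu /lT lt_mu.
have := IHm (val nu); rewrite mcoeff_neq0 (valP nu) => /(_ isT).
by apply: leq_trans; rewrite addSnnS leq_add2l.
Qed.

Lemma hook_op_sum_lowering (c : nat -> int -> wypoly F) Y :
  lowering (op_sum Y (fun k => hook_op (c k) k)).
Proof.
move=> la mu; rewrite /op_sum raddf_sum /=; apply: contraNT; rewrite -leqNgt => le.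
apply/eqP; rewrite big1_seq // => k /andP[_]; rewrite mem_index_iota => /andP[k0 _].
rewrite mcoeffZ raddf_sum /= big1 ?mulr0 // => nu /rim_hook_nbox e.
rewrite mcoeffZ /ket mcoeffU; case: (nu =P mu) => [enu|]; rewrite ?mulr0 //.
by move: le; rewrite -e enu leqNgt -[X in (X < _)%N]add0n ltn_add2r k0.
Qed.

Definition ygen (n : nat) (Y : nat -> wypoly F) : {poly wypoly F} :=
  \sum_(1 <= i < n.+1) (Y i)%:P * 'X^i.

Lemma ygenX n Y : exists q, ygen n Y = 'X * q.
Proof.
exists (\sum_(1 <= i < n.+1) (Y i)%:P * 'X^(i.-1)).
rewrite mulr_sumr; apply: eq_big_nat => -[|i] // _.
by rewrite exprS mulrCA.
Qed.

Lemma ygen_exp_coef n Y m N : (N < m)%N -> (ygen n Y ^+ m)`_N = 0.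
Proof. by move=> lt; case: (ygenX n Y) => q ->; rewrite exprMn coefXnM lt. Qed.

Lemma ygen_exp_trunc n N Y m : (N <= n)%N ->
  (ygen n Y ^+ m)`_N = (ygen N Y ^+ m)`_N.
Proof.
move=> le; apply/eqP; rewrite -subr_eq0 -coefB subrXX.
suff [r ->] : exists r, ygen n Y - ygen N Y = 'X^(N.+1) * r.
  by rewrite -mulrA coefXnM ltnSn.
exists (\sum_(N.+1 <= i < n.+1) (Y i)%:P * 'X^(i - N.+1)).
rewrite /ygen (@big_cat_nat _ _ _ N.+1) //= addrAC subrr add0r mulr_sumr.
apply: eq_big_nat => i /andP[lt _].
by rewrite mulrCA -exprD subnKC.
Qed.

Lemma schur_trunc M n N Y : (N <= M)%N -> (N <= n)%N ->
  \sum_(m < M.+1)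
    scal (m`!%:R^-1) * ((\sum_(1 <= i < n.+1) (Y i)%:P * 'X^i) ^+ m)`_N
  = schur N Y.
Proof.
move=> leM len; rewrite -/(ygen n Y) /schur -/(ygen N Y).
rewrite -(big_mkord xpredT (fun m => scal (m`!%:R^-1) * (ygen n Y ^+ m)`_N)).
rewrite -(big_mkord xpredT (fun m => scal (m`!%:R^-1) * (ygen N Y ^+ m)`_N)).
rewrite (@big_cat_nat _ _ _ N.+1) //= [X in _ + X]big1_seq ?addr0; last first.
  move=> m /=; rewrite mem_index_iota => /andP[lt _]; by rewrite ygen_exp_coef // mulr0.
by apply: eq_bigr => m _; rewrite ygen_exp_trunc.
Qed.

Lemma scal1 : scal 1 = 1.
Proof. by rewrite /scal rmorph1. Qed.

Lemma exp_coef_split (p : {poly wypoly F}) N :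
  \sum_(m < N.+2) scal (m`!%:R^-1) * (p ^+ m)`_N.+1 =
  p`_N.+1 + \sum_(m < N) scal (m.+2`!%:R^-1) * (p ^+ m.+2)`_N.+1.
Proof.
rewrite big_ord_recl [X in X + _ = _](_ : _ = 0); last first.
  by rewrite expr0 coef1 (mulr0 (scal _)).
rewrite add0r big_ord_recl; congr (_ + _).
have -> : ((lift ord0 (@ord0 N))`!%:R^-1 : F) = 1 by rewrite invr1.
by rewrite scal1 mul1r.
Qed.

Lemma schur_diff N Y Y' : (1 <= N)%N ->
  (forall i, (1 <= i < N)%N -> Y i = Y' i) ->
  schur N Y - Y N = schur N Y' - Y' N.
Proof.
case: N => // N _ eqY.
have E Z : schur N.+1 Z - Z N.+1 =
    \sum_(m < N) scal (m.+2`!%:R^-1) * (ygen N Z ^+ m.+2)`_N.+1.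
  rewrite /schur -/(ygen N.+1 Z).
  rewrite exp_coef_split [X in X - _]addrC.
  have EZ : ygen N.+1 Z = ygen N Z + (Z N.+1)%:P * 'X^(N.+1).
    by rewrite /ygen big_nat_recr.
  have -> : (ygen N.+1 Z)`_N.+1 = Z N.+1.
    rewrite EZ coefD coefCM coefXn eqxx mulr1 -[ygen N Z]expr1.
    rewrite /ygen expr1 coef_sum big_nat big1 ?add0r // => i /andP[_ lt].
    by rewrite coefCM coefXn gtn_eqF // mulr0.
  rewrite addrK; apply: eq_bigr => m _; congr (_ * _).
  apply/eqP; rewrite -subr_eq0 -coefB subrXX EZ addrAC subrr add0r -EZ.
  rewrite -mulrA coefCM coefXnM ltnn subnn coef_sum big1 ?mulr0 // => i _.
  case: (ygenX N.+1 Z) => q ->; case: (ygenX N Z) => q' ->.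
  rewrite !exprMn mulrACA -exprD coefXnM.
  by rewrite subnK // -ltnS.
rewrite !E; have -> // : ygen N Y = ygen N Y'.
by apply: eq_big_nat => i lt_i; rewrite eqY.
Qed.

(* The equations schur N Y = M N for N >= 1 determine Y. *)
Lemma schur_determines (M : nat -> wypoly F) :
  exists2 Y : nat -> wypoly F,
    forall N, (1 <= N)%N -> schur N Y = M N
  & forall Y' : nat -> wypoly F, (forall N, (1 <= N)%N -> schur N Y' = M N) ->
      forall N, (1 <= N)%N -> Y' N = Y N.
Proof.
pose step n (Z : nat -> wypoly F) i :=
  if i == n then M n - (schur n Z - Z n) else Z i.
pose Ys := fix Ys n := if n is n'.+1 then step n (Ys n') else fun=> 0.
have stab n i d : (i <= n)%N -> Ys (n + d)%N i = Ys n i.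
  move=> le; elim: d => [|d IHd]; rewrite ?addn0 ?addnS //=.
  by rewrite /step ltn_eqF // ltnS (leq_trans le) // leq_addr.
have eqY : forall N, (1 <= N)%N -> schur N (fun n => Ys n n) = M N.
  case=> // N _; pose Z := fun n => Ys n n; rewrite -/Z.
  have e : schur N.+1 Z - Z N.+1 = schur N.+1 (Ys N) - Ys N N.+1.
    apply: schur_diff => // i /andP[_ lt].
    by rewrite /Z -[in RHS](subnKC (_ : i <= N)%N) // stab.
  have eZ : Z N.+1 = M N.+1 - (schur N.+1 (Ys N) - Ys N N.+1).
    by rewrite /Z /= /step eqxx.
  by rewrite -[LHS](subrK (Z N.+1)) e eZ addrC subrK.
exists (fun n => Ys n n) => // Y' eqY' N.
elim/ltn_ind: N => N IHN N1.
have := @schur_diff N Y' (fun n => Ys n n) N1.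
move=> /(_ _); rewrite eqY // eqY' // => H.
by apply/oppr_inj/(addrI (M N))/H => i /andP[i1 lt]; apply: IHN.
Qed.

Lemma one_row_contained N mu : contained mu (one_row N) -> mu = one_row (nbox mu).
Proof.
move=> c; have := contained_size c; have := valP mu => /=.
rewrite size_nseq; case: (ltnP 0 N) => _ /=; last first.
  by rewrite leqn0 => _ /nilP e; apply/val_inj => /=; rewrite /nbox e.
move=> /andP[_ n0] le1; apply/val_inj => /=; rewrite /nbox.
move: n0 le1; case: (rows mu) => [|a [|b s]] //=.
by rewrite in_cons orbF addn0 eq_sym -lt0n => ->.
Qed.

Lemma nbox_one_row N : nbox (one_row N) = N.
Proof. by rewrite /nbox /= sumn_nseq; case: N => // N; rewrite muln1. Qed.

Lemma row_len_one_row N i : row_len (one_row N) i = if i is 0%N then N else 0%N.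
Proof. by rewrite /row_len /= nth_nseq; case: N => [|N]; case: i => [|[]]. Qed.

Lemma skew_one_row k N : (1 <= k <= N)%N ->
  skew (one_row N) (one_row (N - k)) = [seq (0%N, j) | j <- iota (N - k) k].
Proof.
move=> /andP[k1 kN]; have N1 := leq_trans k1 kN.
by rewrite /skew /= size_nseq N1 /= !row_len_one_row cats0 subKn.
Qed.

Lemma rim_hook_one_row k N mu : (1 <= k <= N)%N ->
  rim_hook k (one_row N) mu = (mu == one_row (N - k)).
Proof.
move=> kN; apply/idP/eqP => [rh|->].
  have /and4P[/one_row_contained -> _ _ _] := rh.
  by have := rim_hook_nbox rh; rewrite nbox_one_row => <-; rewrite addKn.
apply/and4P; rewrite skew_one_row //; split.
- by apply/containedP => -[|i]; rewrite !row_len_one_row // leq_subr.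
- by rewrite size_map size_iota.
- set s := [seq _ | _ <- _].
  pose e (b c : seq_sub s) := adjacent (val b) (val c).
  rewrite /connected_boxes -/e.
  have e_sym : connect_sym e.
    apply: sym_connect_sym => b c; rewrite /e /adjacent.
    rewrite (eq_sym (val b).1) (eq_sym (val b).2 (val c).2).
    by congr (_ && _ || _ && _); rewrite orbC.
  have right d (b c : seq_sub s) : (val c).2 = ((val b).2 + d)%N -> connect e b c.
    elim: d c => [|d IHd] c; have /mapP[j' j's ej'] := valP c;
      have /mapP[j js ej] := valP b; rewrite ?addn0 ?addnS => jj'.
      have -> // : c = b by apply/val_inj; rewrite ej' ej; move: jj'; rewrite ej' ej /= => ->.
    have zs : (0%N, (j + d)%N) \in s.
      apply: map_f; move: js j's; rewrite !mem_iota; move: jj'; rewrite ej ej' /=.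
      by move=> -> /andP[h1 _] /andP[_ h2]; rewrite (leq_trans h1) ?leq_addr ?(ltnW h2).
    apply: (@connect_trans _ _ (SeqSub zs)); first by apply: IHd; rewrite ej.
    by apply: connect1; rewrite /e /adjacent /= jj' ej ej' /= !eqxx orbT.
  apply/forallP => b; apply/forallP => c; have [le|/ltnW le] := leqP (val b).2 (val c).2.
    by apply: (right ((val c).2 - (val b).2)%N); rewrite subnKC.
  by rewrite e_sym; apply: (right ((val b).2 - (val c).2)%N); rewrite subnKC.
- by apply/allP => b /mapP[j _ ->]; rewrite row_len_one_row.
Qed.

Lemma hook_op_one_row c k N : (1 <= k <= N)%N ->
  hook_op c k (one_row N) = c ((N - k)%:Z - 1) *: ket (one_row (N - k)).
Proof.
move=> kN; have /andP[k1 leN] := kN; have N1 := leq_trans k1 leN.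
rewrite /hook_op (eq_bigl (pred1 (one_row (N - k)))); last first.
  by move=> mu; apply: rim_hook_one_row.
rewrite -big_filter filter_pred1_uniq ?below_uniq ?mem_below //; last first.
  by apply/containedP => -[|i]; rewrite !row_len_one_row // leq_subr.
rewrite big_seq1; congr (_ *: _).
have -> : height (one_row N) (one_row (N - k)) = 1%N.
  rewrite /height skew_one_row // /unzip1 -map_comp.
  have -> : map (fst \o pair 0%N) (iota (N - k) k) = nseq k 0%N.
    by elim: (k) (N - k)%N => //= n IHn m; rewrite IHn.
  by case: (k) k1 => // n _ /=; elim: n => //= n; rewrite inE eqxx.
rewrite expr0 mul1r; congr c.
rewrite /jump_start /= size_nseq N1 /= /particle !row_len_one_row inE.
rewrite ifT //; apply/eqP => /addIr [e].
by move: k1 leN; lia.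
Qed.

Lemma linE T v (d : {fset diagram}) : (msupp v `<=` d)%fset ->
  lin T v = \sum_(la <- d) v@_la *: T la.
Proof.
move=> sub; rewrite /lin [RHS](big_fsetID _ (mem (msupp v))) /=.
rewrite [X in _ = _ + X]big_seq_cond [X in _ = _ + X]big1 ?addr0.
  apply: eq_fbigl => la; rewrite !inE /= andbC.
  by apply/idP/andP => [h|[]//]; split=> //; apply: (fsubsetP sub).
by move=> la; rewrite !inE /= => /andP[/andP[_ /mcoeff_outdom ->] _]; rewrite scale0r.
Qed.

Lemma lin_linear T a u v : lin T (a *: u + v) = a *: lin T u + lin T v.
Proof.
pose d := (msupp u `|` msupp v `|` msupp (a *: u + v))%fset.
have s1 : (msupp u `<=` d)%fset by rewrite /d -fsetUA fsubsetUl.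
have s2 : (msupp v `<=` d)%fset by rewrite /d [(msupp u `|` _)%fset]fsetUC -fsetUA fsubsetUl.
rewrite (linE _ s1) (linE _ s2) (@linE _ _ d) ?fsubsetUr // scaler_sumr -big_split /=.
by apply: eq_bigr => la _; rewrite mcoeffD mcoeffZ scalerDl scalerA.
Qed.

Lemma lin_ket T la : lin T (ket la) = T la.
Proof.
have s : (msupp (ket la) `<=` [fset la])%fset by apply: msuppU_le.
by rewrite (linE _ s) big_seq_fset1 /ket mcoeffUU scale1r.
Qed.

Lemma iter_lin_sum T m (I : Type) (r : seq I) (a : I -> wypoly F) (v : I -> fock F) :
  iter m (lin T) (\sum_(i <- r) a i *: v i) =
  \sum_(i <- r) a i *: iter m (lin T) (v i).
Proof.
elim: m => //= m ->; elim: r => [|i r IHr].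
  by rewrite !big_nil /lin msupp0 big_seq_fset0.
by rewrite !big_cons lin_linear IHr.
Qed.

Lemma heis_exp_one_row Y N :
  braket empty_diagram (op_exp (op_sum Y heis) (one_row N)) = schur N Y.
Proof.
rewrite /braket /op_exp raddf_sum /= /schur nbox_one_row.
apply: eq_bigr => m _; rewrite mcoeffZ; congr (_ * _).
rewrite -/(ygen N Y); move: {m}(m : nat) => m.
elim: m N => [|m IHm] N.
  rewrite /= /ket mcoeffU expr0 coef1 /empty_diagram; congr (_ *+ _).
  by case: N.
rewrite iterSr lin_ket /op_sum nbox_one_row.
have -> : \sum_(1 <= k < N.+1) Y k *: heis k (one_row N) =
          \sum_(1 <= k < N.+1) Y k *: ket (one_row (N - k)).
  by apply: eq_big_nat => k kN; rewrite /heis hook_op_one_row // scale1r.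
rewrite iter_lin_sum raddf_sum /= exprS {1}/ygen mulr_suml coef_sum.
apply: eq_big_nat => k /andP[_ kN]; rewrite mcoeffZ IHm -mulrA coefCM coefXnM.
by rewrite ltnNge -ltnS kN /= (ygen_exp_trunc _ _ (leq_subr _ _)).
Qed.

End Operators.

(* Main.v *)
(* On one-row diagrams the sum of the y_k Ltilde_k acts, dually, on power
   series f(u) as the first order operator f |-> v u f' + h f, where v is the
   sum of the y_k u^k and h = w v + g for some g not involving w.  Since the
   derivation v u d/du obeys the Leibniz rule, E(h) := exp(v u d/du + h) 1
   satisfies E(h1 + h2) = E(h1) E(h2).  Writing h(w) for the dependence on w,
   h(2 w) + h(0) = 2 h(w), so E(h(2 w)) E(h(0)) = E(h(w))^2, and comparing with
   E = exp(sum of the Y_i u^i) gives Y_N(2 w) + Y_N(0) = 2 Y_N(w). In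
   characteristic 0, this kills the coefficient of w^i in Y_N for i >= 2,
   because 2^i <> 2. *)
Require Import Defs.
From HB Require Import structures.
From mathcomp Require Import all_boot all_order all_algebra ring zify.

Import GRing.Theory.
Local Open Scope ring_scope.

(** * Exponentials of first-order operators on power series *)

Section Flow.

Set Implicit Arguments.
Unset Strict Implicit.

Variable R : comNzRingType.
Implicit Types (v h f g : {poly R}).

Definition flow v h f : {poly R} := v * ('X * f^`()) + h * f.

Lemma flow_is_zmod_morphism v h : zmod_morphism (flow v h).
Proof. by move=> f g; rewrite /flow derivB; ring. Qed.

HB.instance Definition _ v h :=
  GRing.isZmodMorphism.Build _ _ (flow v h) (flow_is_zmod_morphism v h).

Lemma flowM v h1 h2 f g :
  flow v (h1 + h2) (f * g) = flow v h1 f * g + f * flow v h2 g.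
Proof. by rewrite /flow derivM; ring. Qed.

(** The Leibniz rule [flowM] makes this a binomial formula: each application of the operator hits
    one of the two factors, and Pascal's rule collects the terms. *)
Lemma iter_flowD v h1 h2 m :
  iter m (flow v (h1 + h2)) 1 =
  \sum_(i < m.+1)
    (iter i (flow v h1) 1 * iter (m - i) (flow v h2) 1) *+ 'C(m, i).
Proof.
elim: m => [|m IHm]; first by rewrite big_ord1 /= mulr1.
rewrite iterS IHm raddf_sum /=.
under eq_bigr => i _ do
  rewrite raddfMn /= flowM -!iterS -subSn -1?ltnS // mulrnDl.
rewrite big_split /= [RHS]big_ord_recl [X in X + _]big_ord_recr /= subnn binn.
rewrite [X in _ + X]big_ord_recl [X in _ = _ + X]big_ord_recr /=.
rewrite subnn binn !bin0.
rewrite addrCA; congr (_ + _); rewrite addrAC; congr (_ + _).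
rewrite -big_split /=; apply: eq_bigr => i _.
by rewrite /bump /= subSS binS mulrnDr addrC.
Qed.

Lemma coefX_deriv f N : ('X * f^`())`_N = f`_N *+ N.
Proof. by case: N => [|N]; rewrite coefXM ?mulr0n //= coef_deriv. Qed.

Lemma coefM_low0 v f N : v`_0 = 0 -> (forall i, (i < N)%N -> f`_i = 0) ->
  (v * f)`_N = 0.
Proof.
move=> v0 f0; rewrite coefMr big_ord_recr /= subnn v0 mul0r addr0.
by rewrite big1 // => i _; rewrite f0 // mulr0.
Qed.

(** As [v] and [h] have no constant term, each application raises the order in ['X] by at least
    one. *)
Lemma coef_iter_flow v h m N : v`_0 = 0 -> h`_0 = 0 -> (N < m)%N ->
  (iter m (flow v h) 1)`_N = 0.
Proof.
move=> v0 h0; elim: m N => // m IHm N lt_N /=.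
rewrite /flow coefD !coefM_low0 ?addr0 // => i lt_i.
  by apply: IHm; apply: leq_trans lt_i _.
by rewrite coefX_deriv IHm ?mul0rn //; apply: leq_trans lt_i _.
Qed.

Lemma map_iter_flow (sigma : {rmorphism R -> R}) v h m :
  map_poly sigma (iter m (flow v h) 1) =
  iter m (flow (map_poly sigma v) (map_poly sigma h)) 1.
Proof.
elim: m => [|m IHm]; rewrite ?rmorph1 //= -IHm.
by rewrite /flow rmorphD !rmorphM /= map_polyX deriv_map.
Qed.

Lemma iter_flow0 h m : iter m (flow 0 h) 1 = h ^+ m.
Proof. by elim: m => //= m ->; rewrite /flow mul0r add0r exprS. Qed.

Variable c : nat -> R.
Hypothesis c0 : c 0 = 1.
Hypothesis cM : forall m i, (i <= m)%N -> c m *+ 'C(m, i) = c i * c (m - i).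

Definition flow_term v h m : {poly R} := (c m)%:P * iter m (flow v h) 1.

(* With c m = 1 / m!, the coefficients up to n are those of exp(flow v h) 1. *)
Definition flow_exp n v h : {poly R} := \sum_(m < n.+1) flow_term v h m.

Lemma flow_termD v h1 h2 m :
  flow_term v (h1 + h2) m =
  \sum_(i < m.+1) flow_term v h1 i * flow_term v h2 (m - i).
Proof.
rewrite /flow_term iter_flowD mulr_sumr; apply: eq_bigr => i _.
by rewrite mulrnAr -mulrnAl -polyCMn cM -1?ltnS // polyCM mulrACA.
Qed.

Lemma coef_flow_term v h m N : v`_0 = 0 -> h`_0 = 0 -> (N < m)%N ->
  (flow_term v h m)`_N = 0.
Proof. by move=> v0 h0 lt_N; rewrite coefCM coef_iter_flow // mulr0. Qed.

Lemma coef_flow_expD n v h1 h2 N :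
    v`_0 = 0 -> h1`_0 = 0 -> h2`_0 = 0 -> (N <= n)%N ->
  (flow_exp n v (h1 + h2))`_N = (flow_exp n v h1 * flow_exp n v h2)`_N.
Proof.
move=> v0 h10 h20 le_N.
(* An auxiliary variable marks the index of the term, so that the Cauchy product becomes a product
   of polynomials evaluated at 1. *)
pose gen h := \poly_(i < n.+1) flow_term v h i.
have gen1 h : flow_exp n v h = (gen h).[1].
  by rewrite horner_poly; apply: eq_bigr => i _; rewrite expr1n mulr1.
(* In the product, the terms of index i > n have no coefficients below i. *)
rewrite [in RHS]gen1 [in RHS]gen1 -hornerM.
rewrite (@horner_coef_wide _ (n.+1 + size (gen h1 * gen h2))) ?leq_addl //.
rewrite big_split_ord /= coefD [X in _ = _ + X]coef_sum.
rewrite [X in _ = _ + X]big1 => [|i _].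
  rewrite addr0 [LHS]coef_sum [RHS]coef_sum; apply: eq_bigr => i _.
  rewrite expr1n mulr1 flow_termD [in RHS]coefM !coef_sum.
  apply: eq_bigr => j _.
  by rewrite !coef_poly !(leq_ltn_trans _ (ltn_ord i)) ?leq_subr // -ltnS.
rewrite expr1n mulr1 coefM coef_sum big1 // => j _.
rewrite !coef_poly; case: ifP; rewrite ?mul0r ?coef0 // => _.
case: ifP; rewrite ?mulr0 ?coef0 // => _.
rewrite coefM big1 // => k _.
have [lt_k|le_k] := ltnP k j; first by rewrite coef_flow_term ?mul0r.
rewrite [X in _ * X]coef_flow_term ?mulr0 //.
have := ltn_ord j; have := ltn_ord k; lia.
Qed.

Lemma coef0_flow_exp n v h : v`_0 = 0 -> h`_0 = 0 -> (flow_exp n v h)`_0 = 1.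
Proof.
move=> v0 h0; rewrite coef_sum big_ord_recl big1 => [|i _]; last first.
  by rewrite coef_flow_term.
by rewrite addr0 /flow_term /= c0 mulr1 coef1.
Qed.

Lemma map_flow_exp (sigma : {rmorphism R -> R}) n v h :
    (forall m, sigma (c m) = c m) ->
  map_poly sigma (flow_exp n v h) =
  flow_exp n (map_poly sigma v) (map_poly sigma h).
Proof.
move=> sigma_c; rewrite raddf_sum; apply: eq_bigr => m _ /=.
by rewrite rmorphM /= map_polyC /= sigma_c map_iter_flow.
Qed.

Lemma coefM_eq (p q r s : {poly R}) N :
    (forall i, (i <= N)%N -> p`_i = q`_i) ->
    (forall i, (i <= N)%N -> r`_i = s`_i) ->
  (p * r)`_N = (q * s)`_N.
Proof.
move=> pq rs; rewrite !coefM; apply: eq_bigr => i _.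
by rewrite pq ?rs ?leq_subr // -ltnS.
Qed.

(** To be used with [sigma] and [tau] the substitutions of [2 w] and of [0] for [w]. Both
    exponentials factor by [coef_flow_expD], and morphisms fixing [c] and [v] commute with
    [flow_exp], so the claim reduces to E(h(2 w)) E(h(0)) = E(h(w))^2. *)
Lemma coef_flow_exp_map (sigma tau : {rmorphism R -> R}) n v h (y : {poly R})
    N :
    (forall m, sigma (c m) = c m) -> (forall m, tau (c m) = c m) ->
    map_poly sigma v = v -> map_poly tau v = v ->
    map_poly sigma h + map_poly tau h = h + h ->
    v`_0 = 0 -> h`_0 = 0 -> y`_0 = 0 -> (N <= n)%N ->
    (forall i, (i <= N)%N -> (flow_exp n 0 y)`_i = (flow_exp n v h)`_i) ->
  (flow_exp n 0 (map_poly sigma y + map_poly tau y))`_N =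
  (flow_exp n 0 (y + y))`_N.
Proof.
move=> sigma_c tau_c sigma_v tau_v sigma_tau_h v0 h0 y0 le_N exp_yh.
have map0 (rho : {rmorphism R -> R}) (p : {poly R}) :
  p`_0 = 0 -> (map_poly rho p)`_0 = 0 by rewrite coef_map => ->; apply: rmorph0.
rewrite !coef_flow_expD ?coef0 ?map0 //.
(* The zero derivation part is written as the image of 0, to match [map_flow_exp]. *)
rewrite -[in flow_exp n _ (map_poly sigma y)](rmorph0 (map_poly sigma)).
rewrite -[in flow_exp n _ (map_poly tau y)](rmorph0 (map_poly tau)).
rewrite -!map_flow_exp //.
transitivity (flow_exp n v h * flow_exp n v h)`_N; last first.
  by apply: coefM_eq => i /exp_yh.
rewrite -coef_flow_expD // -sigma_tau_h coef_flow_expD ?map0 //.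
rewrite -[in flow_exp n v (map_poly sigma h)]sigma_v.
rewrite -[in flow_exp n v (map_poly tau h)]tau_v -!map_flow_exp //.
by apply: coefM_eq => i /exp_yh; rewrite !coef_map => ->.
Qed.

End Flow.

Lemma poly_affine (R : nzRingType) (p : {poly R}) :
  (forall i, p`_i.+2 = 0) -> p = (p`_1)%:P * 'X + (p`_0)%:P.
Proof.
move=> p0; apply/polyP => -[|[|i]]; rewrite coefD coefMX !coefC /=.
- by rewrite add0r.
- by rewrite addr0.
- by rewrite addr0 p0.
Qed.

(** * Matrix elements on one-row diagrams *)

Section OneRow.

Set Implicit Arguments.
Unset Strict Implicit.

Variable F : fieldType.
Hypothesis charF : [pchar F] =i pred0.
Local Notation R := (wypoly F).
Implicit Types (v h : {poly R}) (Y : nat -> R).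

Lemma scalM (a b : F) : scal (a * b) = scal a * scal b.
Proof. by rewrite /scal !rmorphM. Qed.

Lemma scalD (a b : F) : scal (a + b) = scal a + scal b.
Proof. by rewrite /scal !rmorphD. Qed.

Lemma scal_nat n : scal (n%:R : F) = n%:R.
Proof. by rewrite /scal !rmorph_nat. Qed.

Lemma natr_neq0_char0 n : (0 < n)%N -> n%:R != 0 :> F.
Proof. by rewrite lt0n; move/pcharf0P: charF => ->. Qed.

Definition invfact m : R := scal (m`!%:R^-1).

Lemma invfact_bin m i : (i <= m)%N ->
  invfact m *+ 'C(m, i) = invfact i * invfact (m - i).
Proof.
rewrite /invfact => le_i.
have -> : scal (m`!%:R^-1 : F) *+ 'C(m, i) = scal (m`!%:R^-1 * 'C(m, i)%:R).
  by rewrite [RHS]scalM scal_nat mulr_natr.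
rewrite -[RHS]scalM; congr (scal _).
rewrite -(bin_fact le_i) !natrM !invfM mulrAC mulVf ?mul1r //.
by rewrite natr_neq0_char0 ?bin_gt0.
Qed.

Lemma coef0_ygen n Y : (ygen n Y)`_0 = 0.
Proof. by have [q ->] := ygenX n Y; rewrite coefXM. Qed.

Lemma coef_ygenM n Y (f : {poly R}) N : (N <= n)%N ->
  (ygen n Y * f)`_N = \sum_(1 <= k < N.+1) Y k * f`_(N - k).
Proof.
move=> le_N; rewrite /ygen (big_cat_nat (n := N.+1)) //= mulrDl coefD.
rewrite !mulr_suml !coef_sum [X in _ + X]big_nat_cond [X in _ + X]big1 ?addr0.
  apply: eq_big_nat => k /andP[_ le_k].
  by rewrite -mulrA coefCM coefXnM ltnNge -ltnS le_k.
by move=> k /andP[/andP[lt_k _] _]; rewrite -mulrA coefCM coefXnM lt_k mulr0.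
Qed.

(** Without a derivation part, the flow is multiplication by [ygen n Y] and its exponential is the
    usual one. *)
Lemma schur_flow_exp n Y N : (N <= n)%N ->
  schur N Y = (flow_exp invfact n 0 (ygen n Y))`_N.
Proof.
move=> le_N; rewrite -(schur_trunc Y le_N le_N) coef_sum; apply: eq_bigr => m _.
by rewrite /flow_term iter_flow0 coefCM.
Qed.

(** The coefficients of the series h: the part of the weight of a jump on a one-row diagram that
    does not depend on the length of the row. *)
Definition weight_y (k : nat) : R :=
  indet_y F k * (indet_w F + scal ((k%:R - 1) / 2)).

(** The jump starts at [N - k - 1/2]. Adding [k/2] gives [N - k], the eigenvalue of u d/du on u^(N -
    k), plus [(k - 1)/2]. *)
Lemma Ltilde_one_row k N : (1 <= k <= N)%N ->
  Ltilde F k (one_row N) =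
  ((N - k)%:R + (indet_w F + scal ((k%:R - 1) / 2))) *: ket F (one_row (N - k)).
Proof.
move=> kN; rewrite /Ltilde hook_op_one_row //; congr (_ *: _).
have e : position F ((N - k)%:Z - 1) + k%:R / 2 = (N - k)%:R + (k%:R - 1) / 2.
  rewrite /position rmorphB /= -[1%:~R]/(1 : F) -pmulrn.
  by field; apply: (@natr_neq0_char0 2).
have := congr1 (@scal F) e.
rewrite (scalD (position _ _)) [RHS]scalD scal_nat => scal_e.
rewrite [RHS]addrCA -scal_e [RHS]addrA; reflexivity.
Qed.

Lemma Ltilde_iter_one_row n m N : (N <= n)%N ->
  braket empty_diagram
    (iter m (lin (op_sum (@indet_y F) (@Ltilde F))) (ket F (one_row N))) =
  (iter m (flow (ygen n (@indet_y F)) (ygen n weight_y)) 1)`_N.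
Proof.
rewrite /braket; elim: m N => [|m IHm] N le_N.
  by rewrite /= /ket mcoeffU coef1; congr (_ *+ _); case: N {le_N}.
rewrite iterSr lin_ket /op_sum nbox_one_row.
under eq_big_nat => k kN do rewrite Ltilde_one_row // scalerA.
rewrite iter_lin_sum raddf_sum /= coefD !coef_ygenM // -big_split /=.
apply: eq_big_nat => k /andP[k1 kN].
rewrite mcoeffZ IHm; last exact: leq_trans (leq_subr _ _) le_N.
rewrite coefX_deriv [_ * (_ + _)]mulrDr [LHS]mulrDl -[X in X + _]mulrA.
by rewrite [_%:R * _]mulr_natl.
Qed.

Lemma Ltilde_exp_one_row n N : (N <= n)%N ->
  braket empty_diagram (op_exp (op_sum (@indet_y F) (@Ltilde F)) (one_row N)) =
  (flow_exp invfact n (ygen n (@indet_y F)) (ygen n weight_y))`_N.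
Proof.
move=> le_N; rewrite /braket /op_exp raddf_sum /= nbox_one_row coef_sum.
rewrite -[RHS](big_mkord xpredT (fun m => (flow_term invfact _ _ m)`_N)).
rewrite (big_cat_nat (n := N.+1)) //=.
rewrite [X in _ = _ + X]big_nat_cond [X in _ = _ + X]big1 ?addr0; last first.
  move=> m /andP[/andP[lt_m _] _].
  by rewrite coef_flow_term ?coef0_ygen.
rewrite big_mkord; apply: eq_bigr => m _.
by rewrite mcoeffZ coefCM -Ltilde_iter_one_row.
Qed.

(** * Rescaling the indeterminate w *)

Definition scale_w (c : ypoly F) : {rmorphism R -> R} := comp_poly (c *: 'X).

Lemma coef_scale_w c (p : R) i : (scale_w c p)`_i = p`_i * c ^+ i.
Proof.
rewrite /= coef_comp_poly; under eq_bigr => j _ do rewrite exprZn coefZ coefXn.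
have [lt_i|le_i] := ltnP i (size p); last first.
  rewrite nth_default // mul0r big1 // => j _.
  by rewrite gtn_eqF ?mulr0 ?(leq_trans (ltn_ord j)).
rewrite (bigD1 (Ordinal lt_i)) //= eqxx mulr1 big1 ?addr0 // => j.
by rewrite -val_eqE eq_sym => /negPf ->; rewrite !mulr0.
Qed.

Lemma scale_w_scal c a : scale_w c (scal a) = scal a.
Proof. exact: comp_polyC. Qed.

Lemma map_ygen (sigma : {rmorphism R -> R}) n Y :
  map_poly sigma (ygen n Y) = ygen n (sigma \o Y).
Proof.
rewrite /ygen raddf_sum; apply: eq_bigr => i _.
by rewrite /= rmorphM /= map_polyC map_polyXn.
Qed.

Lemma map_ygen_indet_y c n :
  map_poly (scale_w c) (ygen n (@indet_y F)) = ygen n (@indet_y F).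
Proof.
rewrite map_ygen; apply: eq_bigr => i _; congr (_%:P * _).
exact: comp_polyC.
Qed.

Lemma ygenD n Y Y' : ygen n Y + ygen n Y' = ygen n (fun k => Y k + Y' k).
Proof.
by rewrite /ygen -big_split; apply: eq_bigr => i _; rewrite /= polyCD mulrDl.
Qed.

(** The weight is affine in w, and 2 and 0 have mean 1. *)
Lemma weight_y_scale_w k :
  scale_w 2 (weight_y k) + scale_w 0 (weight_y k) = weight_y k + weight_y k.
Proof.
have scaleE c : scale_w c (weight_y k) =
    indet_y F k * (c *: indet_w F + scal ((k%:R - 1) / 2)).
  rewrite /weight_y (rmorphM (scale_w c)) (rmorphD (scale_w c)).
  congr (_ * (_ + _)); last exact: scale_w_scal.
    exact: comp_polyC.
  exact: comp_polyX.
rewrite !scaleE /weight_y.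
move: (indet_y F k) (indet_w F) (scal _) => y w a.
by rewrite scale0r add0r scaler_nat mulr2n -!mulrDr [in RHS]addrACA addrA.
Qed.

Lemma schur_scale_w (Y : nat -> R) :
    (forall N, (1 <= N)%N -> schur N Y =
       braket empty_diagram
         (op_exp (op_sum (@indet_y F) (@Ltilde F)) (one_row N))) ->
  forall N, (1 <= N)%N ->
    schur N (fun k => scale_w 2 (Y k) + scale_w 0 (Y k)) =
    schur N (fun k => Y k + Y k).
Proof.
move=> defY N N1.
rewrite !(schur_flow_exp _ (leqnn N)) -!ygenD -!map_ygen.
apply: (coef_flow_exp_map invfact_bin (v := ygen N (@indet_y F))
  (h := ygen N weight_y)).
- by move=> m; apply: scale_w_scal.
- by move=> m; apply: scale_w_scal.
- exact: map_ygen_indet_y.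
- exact: map_ygen_indet_y.
- rewrite !map_ygen !ygenD.
  by apply: eq_bigr => k _; rewrite /= weight_y_scale_w.
- exact: coef0_ygen.
- exact: coef0_ygen.
- exact: coef0_ygen.
- exact: leqnn.
(* The hypothesis [defY] starts at [N = 1]; at 0 both exponentials have coefficient 1. *)
case=> [|i] le_i.
  have f0 : invfact 0 = 1 by rewrite /invfact invr1 scal1.
  transitivity (1 : R); last symmetry.
    exact: (coef0_flow_exp f0 _ (coef0 _ _) (coef0_ygen _ _)).
  exact: (coef0_flow_exp f0 _ (coef0_ygen _ _) (coef0_ygen _ _)).
transitivity (schur i.+1 Y); first by symmetry; apply: schur_flow_exp.
by rewrite defY //; apply: Ltilde_exp_one_row.
Qed.

Lemma ypoly_mulrn_eq0 n (a : ypoly F) : (0 < n)%N -> a *+ n = 0 -> a = 0.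
Proof.
move=> n0 an0; apply/malgP => m; rewrite mcoeff0.
have : a@_m *+ n = 0 by rewrite -mcoeffMn an0 mcoeff0.
rewrite -[LHS]mulr_natr => /eqP.
by rewrite mulf_eq0 (negPf (natr_neq0_char0 n0)) orbF => /eqP.
Qed.

(** A coefficient [a] of degree [i >= 2] satisfies [2^i a = 2 a], hence vanishes in characteristic
    0. *)
Lemma scale_w_affine (p : R) : scale_w 2 p + scale_w 0 p = p + p ->
  p = (p`_1)%:P * indet_w F + (p`_0)%:P.
Proof.
move=> e; apply: poly_affine => i.
have : p`_i.+2 * 2 ^+ i.+2 = p`_i.+2 *+ 2.
  have := congr1 (fun q : R => q`_i.+2) e.
  rewrite [X in X = _]coefD [X in _ = X]coefD !coef_scale_w.
  by rewrite [0 ^+ _]expr0n mulr0 addr0 -mulr2n.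
rewrite -natrX [LHS]mulr_natr => /eqP.
have lt2 : (2 < 2 ^ i.+2)%N by rewrite -[X in (X < _)%N]expn1 ltn_exp2l.
rewrite -subr_eq0 -mulrnBr ?(ltnW lt2) // => /eqP.
by apply: ypoly_mulrn_eq0; rewrite subn_gt0.
Qed.

End OneRow.

Theorem proposition2 (F : fieldType) (charF : [pchar F] =i pred0)
    (Y : nat -> wypoly F)
    (defY : forall N : nat, (1 <= N)%N ->
       schur N Y =
       braket empty_diagram
         (op_exp (op_sum (@indet_y F) (@Ltilde F)) (one_row N))) :
  forall N : nat, (1 <= N)%N ->
    exists C D : ypoly F, Y N = C%:P * indet_w F + D%:P.
Proof.
move=> N N1; exists (Y N)`_1, (Y N)`_0; apply: (scale_w_affine charF).
(* Both [scale_w 2 (Y k) + scale_w 0 (Y k)] and [Y k + Y k] solve these equations, so uniqueness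
   identifies them. *)
have [Z _ uniqZ] := schur_determines (fun N => schur N (fun k => Y k + Y k)).
rewrite (uniqZ _ (schur_scale_w charF defY) N N1).
by rewrite -(uniqZ (fun k => Y k + Y k)).
Qed.
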